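(* Let $f:\mathbb{R}^d\to\mathbb{R}$ be a coercive differentiable function, and let $L>0$. Suppose that for every anchor $\boldsymbol{z}\in\mathbb{R}^d$ the function $f$ is majorized by a surrogate $g(\cdot\mid\boldsymbol{z})$ anchored at $\boldsymbol{z}$, and that the surrogates are uniformly $L$-smooth, i.e. each $g(\cdot\mid\boldsymbol{z}):\mathbb{R}^d\to\mathbb{R}$ is differentiable and its gradient (in the first argument) is Lipschitz continuous with the same constant $L$, independent of $\boldsymbol{z}$. Let $\boldsymbol{y}$ be a minimum point of $f$ and let $\{\boldsymbol{x}_n\}_{n\ge 0}$ be a sequence of iterates of the corresponding MM algorithm. Then for every $n\ge 0$ $$\min_{0\le k\le n}\|\nabla f(\boldsymbol{x}_k)\|^2\;\le\;\frac{2L}{n+1}\,[f(\boldsymbol{x}_0)-f(\boldsymbol{y})].$$ Moreover, when $f$ is continuously differentiable, any limit point of the sequence $\{\boldsymbol{x}_n\}$ is a stationary point of $f$.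
   Context: $\|\cdot\|$ is the Euclidean norm. A surrogate $g(\cdot\mid\boldsymbol{z})$ majorizes $f$ at the anchor $\boldsymbol{z}$ if $g(\boldsymbol{z}\mid\boldsymbol{z})=f(\boldsymbol{z})$ and $f(\boldsymbol{x})\le g(\boldsymbol{x}\mid\boldsymbol{z})$ for all $\boldsymbol{x}$. The MM (majorization-minimization) algorithm starts at some $\boldsymbol{x}_0$ and takes $\boldsymbol{x}_{n+1}$ to be a minimizer of $\boldsymbol{x}\mapsto g(\boldsymbol{x}\mid\boldsymbol{x}_n)$ (minimizers are assumed to exist). A limit point of a sequence is the limit of some convergent subsequence. A stationary point of $f$ is a point where $\nabla f=\boldsymbol{0}$. *)

(* Defs.v *)
From mathcomp Require Import all_boot all_order all_algebra.
From mathcomp Require Import all_classical all_reals all_analysis.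

Set Implicit Arguments.
Unset Strict Implicit.
Unset Printing Implicit Defensive.

Import Order.TTheory GRing.Theory Num.Theory.
Import numFieldNormedType.Exports.

Local Open Scope classical_set_scope.
Local Open Scope ring_scope.

(* The library norm `|u| on matrices is the sup norm. Topology, convergence and
   Frechet differentiability do not depend on the choice of norm in finite
   dimension, but the Lipschitz constant and the gradient bound do. *)
Definition euclidean_norm (R : realType) (d : nat) (u : 'rV[R]_d) : R :=
  Num.sqrt (\sum_(i < d) u 0 i ^+ 2).

Definition gradient (R : realType) (d : nat) (f : 'rV[R]_d -> R)
    (x : 'rV[R]_d) : 'rV[R]_d :=
  \row_(i < d) 'D_(delta_mx 0 i) f x.

Definition coercive (R : realType) (d : nat) (f : 'rV[R]_d -> R) : Prop :=
  forall M : R, exists r : R, forall x : 'rV[R]_d,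
    r < euclidean_norm x -> M < f x.

Definition continuously_differentiable (R : realType) (d : nat)
    (f : 'rV[R]_d -> R) : Prop :=
  (forall x, differentiable f x) /\ continuous (gradient f).

Definition L_smooth (R : realType) (d : nat) (L : R)
    (h : 'rV[R]_d -> R) : Prop :=
  (forall x, differentiable h x) /\
  (forall u v, euclidean_norm (gradient h u - gradient h v)
               <= L * euclidean_norm (u - v)).

Definition majorizes_at (R : realType) (d : nat) (h f : 'rV[R]_d -> R)
    (z : 'rV[R]_d) : Prop :=
  h z = f z /\ forall x, f x <= h x.

Definition minimum_point (R : realType) (d : nat) (h : 'rV[R]_d -> R)
    (y : 'rV[R]_d) : Prop :=
  forall x, h y <= h x.

(* A surrogate g(x | z) is written g z x, the anchor z being the first
   argument. *)
Definition MM_iterates (R : realType) (d : nat)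
    (g : 'rV[R]_d -> 'rV[R]_d -> R) (x : nat -> 'rV[R]_d) : Prop :=
  forall n, minimum_point (g (x n)) (x n.+1).

Definition limit_point_of_seq (R : realType) (d : nat)
    (x : nat -> 'rV[R]_d) (l : 'rV[R]_d) : Prop :=
  exists phi : nat -> nat,
    (forall m n, (m < n)%N -> (phi m < phi n)%N) /\
    (fun k => x (phi k)) @ \oo --> l.

Definition stationary_point (R : realType) (d : nat) (f : 'rV[R]_d -> R)
    (x : 'rV[R]_d) : Prop :=
  gradient f x = 0.

(* The minimum of a 0, ..., a n; the default value of the iterated minimum is
   a 0, which is one of the terms. *)
Definition min_upto (R : realType) (a : nat -> R) (n : nat) : R :=
  \big[Num.min/a 0%N]_(k < n.+1) a k.

(* Main.v *)
Require Import Defs.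
From mathcomp Require Import all_boot all_order all_algebra.
From mathcomp Require Import all_classical all_reals all_analysis.
From mathcomp Require Import ring lra.

Import Order.TTheory GRing.Theory Num.Theory.
Import numFieldNormedType.Exports.

Local Open Scope classical_set_scope.
Local Open Scope ring_scope.

(* Since g(. | z) - f attains its minimum 0 at z, both functions have the same
   gradient at z. The descent lemma for g(. | x_n), tested at the gradient step
   x_n - (1/L) grad f(x_n), then gives
     f(x_{n+1}) <= f(x_n) - |grad f(x_n)|^2 / (2L).
   Telescoping bounds the sum of the |grad f(x_k)|^2 by 2L [f(x_0) - f(y)]:
   the least of n+1 terms is at most their average, and the terms of a
   convergent series tend to 0. *)

Lemma sqr_euclidean_norm {R : realType} {d : nat} (u : 'rV[R]_d) :
  euclidean_norm u ^+ 2 = \sum_(i < d) u 0 i ^+ 2.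
Proof. by rewrite sqr_sqrtr// sumr_ge0// => i _; rewrite sqr_ge0. Qed.

Lemma euclidean_norm_ge0 {R : realType} {d : nat} (u : 'rV[R]_d) :
  0 <= euclidean_norm u.
Proof. exact: sqrtr_ge0. Qed.

Lemma euclidean_normZ {R : realType} {d : nat} (c : R) (u : 'rV[R]_d) :
  euclidean_norm (c *: u) = `|c| * euclidean_norm u.
Proof.
rewrite /euclidean_norm -sqrtr_sqr -sqrtrM ?sqr_ge0// mulr_sumr.
by congr Num.sqrt; apply: eq_bigr => i _; rewrite mxE exprMn.
Qed.

Lemma sqr_coord_le {R : realType} {d : nat} (u : 'rV[R]_d) (i : 'I_d) :
  u 0 i ^+ 2 <= euclidean_norm u ^+ 2.
Proof.
rewrite sqr_euclidean_norm (bigD1 i)//= lerDl.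
by rewrite sumr_ge0// => j _; rewrite sqr_ge0.
Qed.

(** The form of Cauchy-Schwarz that the descent lemma uses: [u] will be a gradient increment along
    the direction [v], and [c] its Lipschitz factor. *)
Lemma dot_le_of_norm_le {R : realType} {d : nat} (c : R) (u v : 'rV[R]_d) :
  0 < c -> euclidean_norm u <= c * euclidean_norm v ->
  \sum_(i < d) u 0 i * v 0 i <= c * euclidean_norm v ^+ 2.
Proof.
move=> c0 uv.
(* AM-GM: 2 a b <= a^2 / c + c b^2 *)
have amgm : 2 * c * (\sum_(i < d) u 0 i * v 0 i)
    <= euclidean_norm u ^+ 2 + c ^+ 2 * euclidean_norm v ^+ 2.
  rewrite !sqr_euclidean_norm !mulr_sumr -big_split/=; apply: ler_sum => i _.
  by have := sqr_ge0 (u 0 i - c * v 0 i); nra.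
have uv2 : euclidean_norm u ^+ 2 <= c ^+ 2 * euclidean_norm v ^+ 2.
  by rewrite -exprMn lerXn2r// nnegrE ?mulr_ge0 ?euclidean_norm_ge0// ltW.
by rewrite -(ler_pM2l (_ : 0 < 2 * c)) ?mulr_gt0//; lra.
Qed.

Lemma derive_gradient {R : realType} {d : nat} (h : 'rV[R]_d -> R)
    (z v : 'rV[R]_d) : differentiable h z ->
  'D_v h z = \sum_(i < d) gradient h z 0 i * v 0 i.
Proof.
move=> dh; rewrite deriveE// {1}(row_sum_delta v) linear_sum.
by apply: eq_bigr => i _; rewrite linearZ/= mxE deriveE// mulrC.
Qed.

Lemma is_derive_line {R : realType} {d : nat} (h : 'rV[R]_d -> R)
    (z v : 'rV[R]_d) (t : R) : differentiable h (z + t *: v) ->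
  is_derive t (1 : R) (fun s : R => h (z + s *: v)) ('D_v h (z + t *: v)).
Proof.
move=> dh.
(* No chain rule is needed: the difference quotient of the restriction to the line is literally the
   directional one at [z + t *: v]. *)
have quotE : (fun k : R => k^-1 *: (((fun s : R => h (z + s *: v)) \o shift t)
      (k *: 1) - h (z + t *: v))) =
    (fun k : R => k^-1 *: ((h \o shift (z + t *: v)) (k *: v)
      - h (z + t *: v))).
  by apply/funext => k /=; rewrite [k *: 1]mulr1 scalerDl addrCA.
split; first by rewrite /derivable quotE; exact: diff_derivable.
by rewrite /derive quotE.
Qed.

Lemma majorizes_at_gradient {R : realType} {d : nat} (h f : 'rV[R]_d -> R)
    (z : 'rV[R]_d) : majorizes_at h f z ->
  (forall u, differentiable h u) -> (forall u, differentiable f u) ->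
  gradient h z = gradient f z.
Proof.
move=> [hz hf] dh df; apply/rowP => i; rewrite !mxE.
set v := delta_mx 0 i.
pose p (t : R) : R := h (z + t *: v) - f (z + t *: v).
have dp (t : R) : is_derive t (1 : R) p
    ('D_v h (z + t *: v) - 'D_v f (z + t *: v)).
  by apply: is_deriveB; apply: is_derive_line.
(* Fermat's rule at the interior minimum 0 of [p]; any open interval around 0 would do. Uniqueness
   of the derivative then equates the two partial derivatives. *)
have p0 : is_derive (0 : R) (1 : R) p 0.
  apply: (@derive1_at_min _ p (-1) 1).
  - lra.
  - by move=> t _; have [] := dp t.
  - by rewrite in_itv/=; apply/andP; split; lra.
  - by move=> t _; rewrite /p scale0r addr0 hz subrr subr_ge0 hf.
have := derive_val (is_derive := dp 0).
rewrite (derive_val (is_derive := p0)) scale0r addr0 => /esym/eqP.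
by rewrite subr_eq0 => /eqP.
Qed.

(** The mean value theorem replaces the usual integral. Subtracting from [h] along the segment the
    linear term and the quadratic [t ^+ 2 * K] leaves a function [q] whose derivative is nonpositive
    on (0, 1), so that [q 1 <= q 0]. *)
Lemma L_smooth_descent {R : realType} {d : nat} (L : R) (h : 'rV[R]_d -> R)
    (z v : 'rV[R]_d) : 0 < L -> L_smooth L h ->
  h (z + v) <= h z + \sum_(i < d) gradient h z 0 i * v 0 i
               + L / 2 * euclidean_norm v ^+ 2.
Proof.
move=> L0 [dh lip]; rewrite -derive_gradient//.
set D := 'D_v h z; set K := L / 2 * _.
pose q (t : R) : R := h (z + t *: v) - (t * D + t ^+ 2 * K).
have dq (t : R) : is_derive t (1 : R) q
    ('D_v h (z + t *: v) - (D + 2 * t * K)).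
  apply: is_deriveB; first exact: is_derive_line.
  have dl : is_derive t (1 : R) (fun s : R => s * D + s ^+ 2 * K)
      (D *: (1 : R) + K *: ((2%:R * t ^+ 1) *: (1 : R))).
    rewrite (_ : (fun s : R => _) = (D *: id) + (K *: (id ^+ 2))).
      exact: is_deriveD.
    by apply/funext => s; rewrite !fctE /GRing.scale/=; ring.
  by apply: is_derive_eq; rewrite /GRing.scale/=; ring.
have cq : {within `[(0 : R), 1], continuous q}.
  apply: continuous_subspaceT => t.
  by apply: differentiable_continuous; apply/derivable1_diffP; have [] := dq t.
have [c c01] := MVT ltr01 (fun t _ => dq t) cq.
move: c01; rewrite in_itv/= => /andP[c0 c1].
rewrite /q scale1r scale0r addr0 subr0 mulr1.
rewrite expr1n expr0n/= !mul1r !mul0r addr0 subr0.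
(* This says that the derivative of [q] at [c] is nonpositive. The two gradients are taken at
   distance [c] times the norm of [v], whence the Lipschitz factor [L * c]. *)
have slope : 'D_v h (z + c *: v) - D <= 2 * c * K.
  rewrite /D !derive_gradient// -sumrB.
  have -> : 2 * c * K = (L * c) * euclidean_norm v ^+ 2 by rewrite /K; field.
  set G := gradient h (z + c *: v); set G0 := gradient h z.
  rewrite (eq_bigr (fun i => (G - G0) 0 i * v 0 i)) => [|i _]; last first.
    by rewrite -mulrBl [(G - G0) 0 i]mxE [(- G0) 0 i]mxE.
  apply: dot_le_of_norm_le; first exact: mulr_gt0.
  apply: le_trans (lip _ _) _.
  by rewrite addrAC subrr add0r euclidean_normZ gtr0_norm// mulrA.
by move: slope; lra.
Qed.

Lemma MM_step_descent {R : realType} {d : nat} (L : R) (h f : 'rV[R]_d -> R)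
    (z w : 'rV[R]_d) : 0 < L -> (forall u, differentiable f u) ->
  majorizes_at h f z -> L_smooth L h -> minimum_point h w ->
  euclidean_norm (gradient f z) ^+ 2 <= 2 * L * (f z - f w).
Proof.
move=> L0 df hf smooth_h w_min.
have gE : gradient h z = gradient f z.
  by apply: majorizes_at_gradient => //; case: smooth_h.
(* This step minimizes the quadratic upper bound: the linear term gives [- G / L], the quadratic one
   [G / (2 * L)]. *)
have := L_smooth_descent L h z (- L^-1 *: gradient f z) L0 smooth_h.
rewrite gE euclidean_normZ normrN exprMn real_normK ?num_real//.
set v := gradient f z.
rewrite (eq_bigr (fun i => - L^-1 * v 0 i ^+ 2)) => [|i _]; last first.
  by rewrite [(_ *: v) 0 i]mxE mulrCA -expr2.
rewrite -mulr_sumr -sqr_euclidean_norm.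
have [hz fh] := hf; rewrite hz.
set G := euclidean_norm _ ^+ 2 => step.
(* Majorization passes from [f w] to [h w], and minimality of [w] from there to the value of [h] at
   the gradient step. *)
have fw : f w <= f z - G / (2 * L).
  apply: le_trans (fh w) _; apply: le_trans (w_min _) _.
  apply: le_trans step _; rewrite le_eqVlt; apply/orP; left; apply/eqP.
  by field; lra.
by rewrite mulrC -ler_pdivrMr ?mulr_gt0//; lra.
Qed.

Lemma min_upto_le {R : realType} (a : nat -> R) (n : nat) :
  n.+1%:R * min_upto a n <= \sum_(k < n.+1) a k.
Proof.
rewrite mulr_natl -[n.+1 in X in X <= _]card_ord -sumr_const.
by apply: ler_sum => i _; exact: bigmin_le_cond.
Qed.

Lemma increasing_cvgn_infty (phi : nat -> nat) :
  (forall m n, (m < n)%N -> (phi m < phi n)%N) -> phi @ \oo --> \oo.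
Proof.
move=> phi_lt.
have phi_ge n : (n <= phi n)%N.
  by elim: n => // n IH; apply: leq_ltn_trans IH _; exact: phi_lt.
by move=> A [N _ NA]; exists N => // n Nn; apply: NA; exact: leq_trans Nn _.
Qed.

Theorem proposition2p8 (R : realType) (d : nat)
    (f : 'rV[R]_d -> R) (L : R) (g : 'rV[R]_d -> 'rV[R]_d -> R)
    (y : 'rV[R]_d) (x : nat -> 'rV[R]_d)
    (f_coercive : coercive f)
    (f_diff : forall z, differentiable f z)
    (L_gt0 : 0 < L)
    (g_majorizes : forall z, majorizes_at (g z) f z)
    (g_smooth : forall z, L_smooth L (g z))
    (y_min : minimum_point f y)
    (x_MM : MM_iterates g x) :
  (forall n : nat,
     min_upto (fun k => euclidean_norm (gradient f (x k)) ^+ 2) n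
     <= 2 * L / n.+1%:R * (f (x 0%N) - f y)) /\
  (continuously_differentiable f ->
     forall l : 'rV[R]_d, limit_point_of_seq x l -> stationary_point f l).
Proof.
pose a k := euclidean_norm (gradient f (x k)) ^+ 2.
have sum_a n : \sum_(0 <= k < n) a k <= 2 * L * (f (x 0%N) - f y).
  (* The telescoped bound ends in [f (x n)], which is at least [f y]. *)
  apply: (@le_trans _ _ (2 * L * (f (x 0%N) - f (x n)))).
    elim: n => [|n IH]; first by rewrite big_geq// subrr mulr0.
    rewrite big_nat_recr//=.
    have := MM_step_descent L (g (x n)) f (x n) (x n.+1) L_gt0 f_diff
      (g_majorizes _) (g_smooth _) (x_MM n).
    by rewrite -/(a n); lra.
  by rewrite ler_pM2l ?mulr_gt0// lerD2l lerN2.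
split=> [n|[_ grad_cont] l [phi [phi_lt phi_l]]].
  rewrite mulrAC ler_pdivlMr ?ltr0n// mulrC.
  by apply: le_trans (min_upto_le a n) _; rewrite -(big_mkord xpredT a).
have a0 : a @ \oo --> 0.
  apply: cvg_series_cvg_0; apply: nondecreasing_is_cvgn.
    apply/nondecreasing_seqP => n.
    by rewrite /series/= big_nat_recr//= lerDl sqr_ge0.
  by exists (2 * L * (f (x 0%N) - f y)) => _ [n _ <-]; exact: sum_a.
have aphi0 : a \o phi @ \oo --> 0.
  by apply: cvg_comp a0; exact: increasing_cvgn_infty.
apply/rowP => i; rewrite [RHS]mxE.
(* Each squared coordinate of the gradient has two limits along the subsequence: its value at [l],
   by continuity, and 0, being squeezed below [a \o phi]. They must agree. *)
have gi : (fun k => gradient f (x (phi k)) 0 i) @ \oo --> gradient f l 0 i.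
  apply: (@cvg_comp _ _ _ (fun k => gradient f (x (phi k)))
    (fun M : 'rV[R]_d => M 0 i) _ (nbhs (gradient f l))).
    exact: (cvg_comp _ _ phi_l (grad_cont l)).
  exact: coord_continuous.
have gi2 : (fun k => gradient f (x (phi k)) 0 i ^+ 2) @ \oo
    --> gradient f l 0 i ^+ 2.
  by rewrite expr2; under eq_fun do rewrite expr2; exact: cvgM.
have gi2_0 : (fun k => gradient f (x (phi k)) 0 i ^+ 2) @ \oo --> (0 : R).
  apply: (squeeze_cvgr _ (cvg_cst _) aphi0); apply: nearW => k.
  by rewrite sqr_ge0 sqr_coord_le.
have /eqP : gradient f l 0 i ^+ 2 = 0 by exact: cvg_unique gi2 gi2_0.
by rewrite sqrf_eq0 => /eqP.
Qed.
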